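(* Let $(X,\mu)$ be a measure space with a (separable) ball-basis $\mathscr B$, and let $\{F_B:B\in\mathscr B\}$ be a family of measurable sets such that $\mu(F_B)<\alpha\mu(B)$ for every $B\in\mathscr B$, where $0<\alpha<1/(10\mathcal K^7)$. Then for any ball $A_0$ one can find a countable tree-collection of balls $\mathcal S$ which is $\gamma$-sparse with an admissible constant $\gamma\in(0,1)$ and has a double hull-ball $[[A_0]]$ as its root-ball, such that: (a1) $G\in\mathrm{Ch}(A)\Rightarrow G\subset A$; (a2) $\mu\big(A_0\setminus\bigcup_{A\in\mathcal S}(A\setminus F_A)\big)=0$; (a3) for any $A\in\mathcal S$, $\ \sum_{G\in\mathrm{Ch}(A)}\mu(G)\lesssim\alpha\,\mu(A)$; (a4) if $A\in\mathcal S$ and $G\in\mathrm{Ch}(A)$, then for any ball $G'\supsetneq G$, $\ \mu(G'\cap F_A)<\mu(G')/2$. If the ball-basis $\mathscr B$ is doubling, then one can claim the inequality in (a4) for $G'=G$ as well.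
   Context: Ball-basis. Let $(X,\mathfrak M,\mu)$ be a measure space. A family $\mathscr B\subset\mathfrak M$ (balls) is a ball-basis if: (B1) $0<\mu(B)<\infty$ for $B\in\mathscr B$; (B2) any two points lie in a common ball; (B3) for any $E\in\mathfrak M$, $\varepsilon>0$ there is a finite or infinite sequence of balls $B_k$ with $\mu(E\triangle\bigcup_kB_k)<\varepsilon$; (B4) for any $B\in\mathscr B$ there is a ball $[B]\in\mathscr B$ (hull-ball of $B$; $[[B]]$ is a hull-ball of $[B]$, a double hull-ball of $B$) with $B^*:=\bigcup_{A\in\mathscr B:\ \mu(A)\le2\mu(B),\ A\cap B\ne\varnothing}A\subset[B]$ and $\mu([B])\le\mathcal K\mu(B)$, $\mathcal K$ independent of $B$. All ball-bases are assumed separable (arbitrary unions of balls are measurable). $\mathscr B$ is doubling if there is $\eta>1$ such that every ball $B$ with $B^*\ne X$ admits a ball $B'\supsetneq B$ with $\mu(B')\le\eta\mu(B)$. Tree-collection. A family of balls $\mathcal S$ is a tree-collection with root-ball $R\in\mathcal S$ if to each $A\in\mathcal S$ there is attached a (possibly empty) children-collection $\mathrm{Ch}(A)\subset\mathcal S$, $A\notin\mathrm{Ch}(A)$, such that for every $A\in\mathcal S$ there is a chain $R=A_0,A_1,\dots,A_n=A$ in $\mathcal S$ with $A_{j+1}\in\mathrm{Ch}(A_j)$, $0\le j<n$ (each non-root element $G$ has a parent $\mathrm{pr}(G)$, the $A$ with $G\in\mathrm{Ch}(A)$). A collection $\mathcal S$ is $\gamma$-sparse if there are pairwise disjoint measurable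 $E_B\subset B$ ($B\in\mathcal S$) with $\mu(E_B)\ge\gamma\mu(B)$. Admissible constants depend only on $\mathcal K$ (and on $\eta$ if $\mathscr B$ is doubling); $a\lesssim b$ means $a\le c\,b$ with $c$ admissible.
   Formalization: In the doubling case the bound on α is 1/(10 K^5 max(K,η)^2), equal to 1/(10 K^7) when η ≤ K; with 1/(10 K^7) alone the last sentence fails (100-adic intervals, K=1, η=100, α=1/20, A_0=[0,1), F_{A_0}=[0,1/100)). *)

(* Defs.v *)
From HB Require Import structures.
From mathcomp Require Import all_boot all_order all_algebra.
From mathcomp Require Import all_classical all_reals all_analysis.

Set Implicit Arguments.
Unset Strict Implicit.
Unset Printing Implicit Defensive.

Import Order.TTheory GRing.Theory Num.Theory.
Import numFieldNormedType.Exports.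

Local Open Scope classical_set_scope.
Local Open Scope ring_scope.
Local Open Scope ereal_scope.

Section BallBasis.
Context {R : realType} {d : measure_display} {X : measurableType d}.
Variables (mu : {measure set X -> \bar R}) (balls : set (set X)).

Definition star (B : set X) : set X :=
  \bigcup_(A in [set A | [/\ balls A, mu A <= 2%:E * mu B & A `&` B !=set0]]) A.

(* The hull-ball [B] need not be unique: [hull_ball K B H] says that H is an
   admissible choice of [B], with constant K. *)
Definition hull_ball (K : R) (B H : set X) : Prop :=
  [/\ balls H, star B `<=` H & mu H <= K%:E * mu B].

(* In (B3) a finite or infinite sequence of balls is a countable subfamily D.
   The last clause is separability. *)
Record ball_basis (K : R) : Prop := BallBasisAxioms {
  ball_measurable : forall B, balls B -> measurable B;
  ball_measure : forall B, balls B -> 0 < mu B /\ mu B < +oo;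
  ball_two_points : forall x y : X, exists B, [/\ balls B, B x & B y];
  ball_approx : forall (E : set X) (e : R), measurable E -> (0 < e)%R ->
    exists D : set (set X),
      [/\ countable D, D `<=` balls & mu (E `+` \bigcup_(B in D) B) < e%:E];
  ball_hull : forall B, balls B -> exists H, hull_ball K B H;
  ball_separable : forall D : set (set X), D `<=` balls ->
    measurable (\bigcup_(B in D) B) }.

Definition doubling (eta : R) : Prop :=
  (1 < eta)%R /\
  forall B, balls B -> star B <> setT ->
    exists B', [/\ balls B', B `<` B' & mu B' <= eta%:E * mu B].

Definition sparse (gamma : R) (S : set (set X)) : Prop :=
  exists E : set X -> set X,
    trivIset S E /\
    forall B, S B ->
      [/\ measurable (E B), E B `<=` B & gamma%:E * mu B <= mu (E B)].

(* [tree_parent] makes the parent of a non-root ball well defined;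
   [tree_chain] already gives its existence. *)
Record tree_collection (S : set (set X)) (Ch : set X -> set (set X))
    (root : set X) : Prop := TreeCollection {
  tree_balls : S `<=` balls;
  tree_root : S root;
  tree_children : forall A, S A -> Ch A `<=` S;
  tree_irreflexive : forall A, S A -> ~ Ch A A;
  tree_chain : forall A, S A -> exists (n : nat) (a : nat -> set X),
    [/\ a 0%N = root, a n = A, forall j, (j <= n)%N -> S (a j)
      & forall j, (j < n)%N -> Ch (a j) (a j.+1)];
  tree_parent : forall A A' G, S A -> S A' -> Ch A G -> Ch A' G -> A = A' }.

End BallBasis.

(* Main.v *)
(* Every node of the tree carries a core b, the territory t = [b] and a ball
   a containing [[b]].  Nodes are selected greedily, by decreasing size of their
   cores up to a factor 2: if the last selected territory containing a point x is
   that of a node with ball A, and x is in F_A, then, x being almost surely a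
   density point, x lies in balls half filled by F_A, and a nearly largest of them is
   a candidate for the core of a child of A; its maximality gives (a4).  A core
   meeting an earlier core b_j is contained in t_j, so its parent is not older than
   j.  This yields
   - disjointness of the cores of siblings, hence (a3);
   - that a core younger than b_j and meeting it has a parent i >= j whose ball
     meets b_j.  Those of these i > j whose own parent is older than j have
     disjoint cores inside a dilation of b_j, the others descend from them or from
     j, so the mu(a_i) sum up to O(mu(b_j)), and their children cover at most 3/4
     of b_j.  The rest of b_j is the set E required by sparseness.
   By Borel-Cantelli almost every x lies in finitely many territories.  If x were in
   F_A for the last of them, its candidate would compete for ever against cores of
   vanishing measure; hence (a2). *)

Require Import Defs.
From HB Require Import structures.
From mathcomp Require Import all_boot all_order all_algebra.
From mathcomp Require Import all_classical all_reals all_analysis.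
From mathcomp Require Import lra ring.

Set Implicit Arguments.
Unset Strict Implicit.
Unset Printing Implicit Defensive.

Import Order.TTheory GRing.Theory Num.Theory.
Import numFieldNormedType.Exports.

Local Open Scope classical_set_scope.
Local Open Scope ring_scope.

(** * Finite measures *)

Section FiniteMeasure.
Context {R : realType} {d : measure_display} {X : measurableType d}.
Variable mu : {measure set X -> \bar R}.
Implicit Types A B : set X.

Definition finite_meas A := measurable A /\ (mu A < +oo)%E.

Local Notation m A := (fine (mu A)).

Lemma meas_fine A : finite_meas A -> mu A = (m A)%:E.
Proof. by move=> [_ fA]; rewrite fineK// ge0_fin_numE. Qed.

Lemma fine_meas_ge0 A : 0 <= m A.
Proof. exact: fine_ge0. Qed.

Lemma finite_meas0 : finite_meas set0.
Proof. by split; rewrite ?measure0. Qed.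

Lemma finite_measS A B :
  finite_meas B -> measurable A -> A `<=` B -> finite_meas A.
Proof.
move=> [mB fB] mA AB; split=> //; apply: le_lt_trans fB.
by rewrite le_measure ?inE.
Qed.

Lemma fine_measS A B :
  finite_meas B -> measurable A -> A `<=` B -> m A <= m B.
Proof.
move=> fB mA AB; have fA := finite_measS fB mA AB.
rewrite -lee_fin -!meas_fine// le_measure ?inE//; exact: fB.1.
Qed.

Lemma finite_measU A B :
  finite_meas A -> finite_meas B -> finite_meas (A `|` B).
Proof.
move=> [mA fA] [mB fB]; split; first exact: measurableU.
by apply: le_lt_trans (measureU2 _ mA mB) _; rewrite lte_add_pinfty.
Qed.

Lemma fine_measU_le A B : finite_meas A -> finite_meas B ->
  m (A `|` B) <= m A + m B.
Proof.
move=> fA fB; rewrite -lee_fin EFinD -!meas_fine//; last exact: finite_measU.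
by apply: measureU2; by [case: fA|case: fB].
Qed.

Lemma fine_measU A B : finite_meas A -> finite_meas B -> A `&` B = set0 ->
  m (A `|` B) = m A + m B.
Proof.
move=> fA fB AB; apply: EFin_inj.
rewrite EFinD -!meas_fine//; last exact: finite_measU.
by apply: measureU => //; by [case: fA|case: fB].
Qed.

Lemma fine_measID A B : finite_meas A -> measurable B ->
  m A = m (A `\` B) + m (A `&` B).
Proof.
move=> fA mB; rewrite -fine_measU.
- by rewrite -setDDr setDv setD0.
- apply: (finite_measS fA); last exact: subDsetl.
  by apply: measurableD => //; case: fA.
- apply: (finite_measS fA); last exact: subIsetl.
  by apply: measurableI => //; case: fA.
- by rewrite setDE setIACA setICl setI0.
Qed.

Lemma sum_fine_meas_le n (P : pred nat) (f : nat -> set X) (Z : set X) :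
  finite_meas Z -> (forall i, measurable (f i)) ->
  (forall i, (i < n)%N -> P i -> f i `<=` Z) ->
  (forall i k, P i -> P k -> (i < k)%N -> f i `&` f k = set0) ->
  \sum_(i < n | P i) m (f i) <= m Z.
Proof.
move=> fZ mf fsub fdisj.
have fin i : (i < n)%N -> P i -> finite_meas (f i).
  by move=> ni Pi; apply: (finite_measS fZ) => //; exact: fsub.
suff H k : (k <= n)%N ->
    [/\ \sum_(i < k | P i) m (f i) = m (\bigcup_(i in [set i | (i < k)%N /\ P i]) f i)
     & finite_meas (\bigcup_(i in [set i | (i < k)%N /\ P i]) f i)].
  have [-> [mU _]] := H n (leqnn n).
  by apply: fine_measS => // x [i [ni Pi]] fx; exact: (fsub _ ni Pi).
elim: k => [|k IH] kn.
  rewrite big_ord0 (_ : \bigcup_(i in _) _ = set0) ?measure0//.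
    by split=> //; exact: finite_meas0.
  by rewrite -subset0 => x [i []].
have [IH1 IH2] := IH (ltnW kn).
rewrite big_mkcond big_ord_recr/= -big_mkcond/= IH1.
case: ifPn => Pk; last first.
  rewrite addr0 (_ : [set i | (i < k.+1)%N /\ P i] = [set i | (i < k)%N /\ P i])//.
  apply/seteqP; split=> i /= [ik Pi]; split => //; last exact: ltnW.
  rewrite ltnS leq_eqVlt in ik; case/orP: ik => // /eqP ik.
  by rewrite ik (negbTE Pk) in Pi.
have -> : \bigcup_(i in [set i | (i < k.+1)%N /\ P i]) f i =
    (\bigcup_(i in [set i | (i < k)%N /\ P i]) f i) `|` f k.
  apply/seteqP; split=> x.
    move=> [i [ik Pi] fx]; rewrite ltnS leq_eqVlt in ik.
    by case/orP: ik => [/eqP <-|ik]; [right|left; exists i].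
  move=> [[i [ik Pi] fx]|fx]; first by exists i => //; split=> //; exact: ltnW.
  by exists k.
have fk := fin _ kn Pk.
split; last exact: finite_measU.
rewrite fine_measU// -subset0 => x [[i [ik Pi] fx] fkx].
by have : (f i `&` f k) x by []; rewrite fdisj.
Qed.

(** Estimates are proved for finite partial sums in [R]; this carries them over to series in the
    extended reals. *)
Lemma nneseries_fine_meas_le (Q : pred nat) (f : nat -> set X) (C : R) :
  (forall i, finite_meas (f i)) ->
  (forall n, \sum_(i < n | Q i) m (f i) <= C) ->
  (\sum_(i <oo | Q i) mu (f i) <= C%:E)%E.
Proof.
move=> ff fC; apply: lime_le; first exact: is_cvg_nneseries_cond.
apply: nearW => n /=; rewrite big_mkord.
under eq_bigr do rewrite meas_fine//.
by rewrite sumEFin lee_fin.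
Qed.

Lemma finite_meas_bigcup_seq (s : seq (set X)) :
  (forall B, B \in s -> finite_meas B) ->
  finite_meas (\bigcup_(B in [set` s]) B).
Proof.
elim: s => [|B s IH] sP.
  by rewrite set_nil bigcup_set0; exact: finite_meas0.
rewrite (_ : [set` B :: s] = B |` [set` s]); last first.
  apply/seteqP; split=> C /=; rewrite inE.
    by move=> /orP[/eqP|]; [left|right].
  by move=> [->|->]; rewrite ?eqxx ?orbT.
rewrite bigcup_setU1; apply: finite_measU.
  by apply: sP; rewrite inE eqxx.
by apply: IH => C Cs; apply: sP; rewrite inE Cs orbT.
Qed.

End FiniteMeasure.

(** The supremum need not be attained, but some value exceeds half of it. The loss of a factor 2 is
    harmless because [star] admits balls of up to twice the measure. *)
Lemma exists_half_max (R : realType) (T : Type) (Q : T -> Prop) (f : T -> R)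
    (C : R) :
  (exists t, Q t) -> (forall t, Q t -> 0 < f t <= C) ->
  exists t, Q t /\ forall u, Q u -> f u <= 2 * f t.
Proof.
move=> [t0 Qt0] Qf.
have hs : has_sup [set f t | t in Q].
  split; first by exists (f t0), t0.
  by exists C => _ [t Qt <-]; case/andP: (Qf _ Qt).
have s0 : 0 < sup [set f t | t in Q].
  have /andP[ft0 _] := Qf _ Qt0; apply: lt_le_trans ft0 _.
  by apply: sup_upper_bound => //; exists t0.
have [|_ [t Qt <-] ht] := @sup_adherent _ _ (sup [set f t | t in Q] / 2) _ hs.
  by rewrite divr_gt0.
exists t; split=> // u Qu.
have : f u <= sup [set f t | t in Q] by apply: sup_upper_bound => //; exists u.
lra.
Qed.

(** * Balls, hulls and density points *)

Section Balls.
Context {R : realType} {d : measure_display} {X : measurableType d}.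
Variables (mu : {measure set X -> \bar R}) (balls : set (set X)) (K : R).
Hypothesis bb : ball_basis mu balls K.
Implicit Types A B H : set X.

Local Notation m A := (fine (mu A)).

Lemma ball_finite B : balls B -> finite_meas mu B.
Proof.
by move=> bB; split; [exact: (ball_measurable bb)|case: (ball_measure bb bB)].
Qed.

Lemma ball_fine_gt0 B : balls B -> 0 < m B.
Proof.
by move=> bB; rewrite -lte_fin -meas_fine//; [case: (ball_measure bb bB)|exact: ball_finite].
Qed.

Lemma ball_neq0 B : balls B -> B !=set0.
Proof.
move=> bB; apply/set0P/eqP => B0.
by have := ball_fine_gt0 bB; rewrite B0 measure0 ltxx.
Qed.

Lemma fine_meas_ball A B : finite_meas mu A -> balls B -> A `<=` B -> m A <= m B.
Proof. by move=> [mA _] /ball_finite fB; exact: fine_measS. Qed.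

Lemma hull_star B H A : balls B -> hull_ball mu balls K B H -> balls A ->
  m A <= 2 * m B -> A `&` B !=set0 -> A `<=` H.
Proof.
move=> bB [bH sH _] bA AB AB0 x Ax; apply: sH; exists A => //; split=> //.
by rewrite (meas_fine (ball_finite bA)) (meas_fine (ball_finite bB)) -EFinM lee_fin.
Qed.

Lemma hull_sub B H : balls B -> hull_ball mu balls K B H -> B `<=` H.
Proof.
move=> bB hH; apply: (hull_star bB hH bB); last by rewrite setIid; exact: ball_neq0.
by have := ball_fine_gt0 bB; lra.
Qed.

Lemma hull_fine_le B H : balls B -> hull_ball mu balls K B H -> m H <= K * m B.
Proof.
move=> bB [bH _].
by rewrite (meas_fine (ball_finite bH)) (meas_fine (ball_finite bB)) -EFinM lee_fin.
Qed.

Lemma hull_ball_ball B H : hull_ball mu balls K B H -> balls H.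
Proof. by case. Qed.

Lemma hull_const_ge1 B : balls B -> 1 <= K.
Proof.
move=> bB; have [H hH] := ball_hull bb bB.
have := hull_fine_le bB hH.
have := fine_meas_ball (ball_finite bB) (hull_ball_ball hH) (hull_sub bB hH).
have := ball_fine_gt0 bB => B0 h1 h2; have := le_trans h1 h2.
by rewrite -{1}[m B]mul1r ler_pM2r.
Qed.

(** Vitali's argument by induction on the number of balls: the hull of a nearly largest ball [B]
    absorbs all balls meeting [B] and costs at most [2 * K] times the part of [B] inside [W], while
    the remaining balls avoid [B], so that their share of [W] is disjoint from that of [B]. *)
Lemma finite_vitali (W : set X) (s : seq (set X)) : measurable W ->
  (forall B, B \in s -> balls B /\ m B <= 2 * m (B `&` W)) ->
  m (\bigcup_(B in [set` s]) B) <= 2 * K * m (W `&` \bigcup_(B in [set` s]) B).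
Proof.
move=> mW; have [n] := ubnP (size s); elim: n s => // n IH s /ltnSE sn sP.
have bs B : B \in s -> balls B by move=> /sP[].
have fU (t : seq (set X)) : {subset t <= s} ->
    finite_meas mu (\bigcup_(B in [set` t]) B).
  by move=> ts; apply: finite_meas_bigcup_seq => B /ts/bs/ball_finite.
have [s0|] := pselect (s = [::]).
  by rewrite s0 set_nil bigcup_set0 setI0 measure0 mulr0.
move=> /eqP s0.
have [B [Bs Bmax]] : exists B, B \in s /\ forall C, C \in s -> m C <= 2 * m B.
  apply: (@exists_half_max _ _ (fun B => B \in s) (fun B => m B)
    (m (\bigcup_(B in [set` s]) B))).
    by case: s s0 {IH sn sP bs fU} => // B s _; exists B; rewrite inE eqxx.
  move=> C Cs; rewrite ball_fine_gt0/=; last exact: bs.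
  apply: fine_measS; [exact: fU| |by move=> x Cx; exists C].
  by have [] := ball_finite (bs _ Cs).
have [bB hB] := sP _ Bs; have [H hH] := ball_hull bb bB.
pose t := [seq C <- s | `[< C `&` B = set0 >]].
have ts : {subset t <= s} by move=> C; rewrite mem_filter => /andP[].
have tn : (size t < n)%N.
  apply: leq_trans sn; rewrite size_filter -(count_predC (fun C => `[< C `&` B = set0 >]) s).
  rewrite -[X in (X < _)%N]addn0 ltn_add2l -has_count; apply/hasP; exists B => //=.
  by apply/asboolPn; rewrite setIid; apply/eqP/set0P; exact: ball_neq0.
have sub : \bigcup_(C in [set` s]) C `<=` H `|` \bigcup_(C in [set` t]) C.
  move=> x [C Cs Cx]; have [CB|/eqP/set0P CB] := pselect (C `&` B = set0).
    by right; exists C => //=; rewrite mem_filter Cs andbT; apply/asboolP.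
  by left; apply: (hull_star bB hH _ _ CB) Cx; [exact: bs|exact: Bmax].
have fs := fU _ (fun _ h => h); have ft := fU _ ts.
have fH := ball_finite (hull_ball_ball hH).
apply: le_trans (fine_measS (finite_measU fH ft) fs.1 sub) _.
apply: le_trans (fine_measU_le fH ft) _.
have K1 := hull_const_ge1 bB.
have IHt := IH t tn (fun C Ct => sP C (ts _ Ct)).
have h1 := hull_fine_le bB hH.
have fI : finite_meas mu (B `&` W).
  by apply: (finite_measS (ball_finite bB)) => //; apply: measurableI => //; case: (ball_finite bB).
have fJ : finite_meas mu (W `&` \bigcup_(C in [set` t]) C).
  by apply: (finite_measS ft) => //; apply: measurableI => //; case: ft.
have h2 : m (B `&` W) + m (W `&` \bigcup_(C in [set` t]) C)
    <= m (W `&` \bigcup_(C in [set` s]) C).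
  rewrite -fine_measU//; last first.
    rewrite -subset0 => x [[Bx _] [_ [C /=]]].
    rewrite mem_filter => /andP[/asboolP CB _] Cx.
    by have : (C `&` B) x by []; rewrite CB.
  apply: fine_measS.
  - by apply: (finite_measS fs) => //; apply: measurableI => //; case: fs.
  - by apply: measurableU; [case: fI|case: fJ].
  - by move=> x [[Bx Wx]|[Wx [C Ct Cx]]]; split=> //; [exists B|exists C => //; exact: ts].
nra.
Qed.

(** Finite subfamilies exhaust [D], and the measure is continuous along increasing unions. The set
    [Z] gives a bound that does not depend on the subfamily. *)
Lemma countable_vitali (W Z : set X) (D : set (set X)) : 0 <= K -> measurable W ->
  finite_meas mu Z -> countable D -> D `<=` balls ->
  (forall B, D B -> m B <= 2 * m (B `&` W) /\ W `&` B `<=` Z) ->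
  (mu (\bigcup_(B in D) B) <= (2 * K * m Z)%:E)%E.
Proof.
move=> K0 mW fZ /countable_injP[f finj] Db DP.
have [[B0 DB0]|/forallNP D0] := pselect (exists B, D B); last first.
  rewrite (_ : \bigcup_(B in D) B = set0) ?measure0.
    rewrite lee_fin mulr_ge0 ?fine_meas_ge0// mulr_ge0//.
  by rewrite -subset0 => x [B /D0].
pose F n := \bigcup_(B in D `&` [set B | (f B < n)%N]) B.
have UF : \bigcup_(B in D) B = \bigcup_n F n.
  apply/seteqP; split=> x.
    by move=> [B DB Bx]; exists (f B).+1 => //; exists B => //; split=> //=.
  by move=> [n _ [B [DB _] Bx]]; exists B.
have mF n : measurable (F n).
  by apply: (ball_separable bb) => B [/Db].
have mUF : measurable (\bigcup_n F n) by exact: bigcup_measurable.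
have ndF : nondecreasing_seq F.
  move=> i j ij; apply/subsetPset => x [B [DB fB] Bx]; exists B => //; split=> //=.
  exact: leq_trans ij.
have cF := nondecreasing_cvg_mu (mu := mu) mF mUF ndF.
rewrite UF; apply: (cvge_to_le cF).
apply: nearW => n /=.
have finD : finite_set (D `&` [set B | (f B < n)%N]).
  have fi : {in D `&` [set B | (f B < n)%N] &, injective f}.
    by move=> A B /set_mem[DA _] /set_mem[DB _]; apply: finj; exact: mem_set.
  rewrite -(eq_finite_set (inj_card_eq fi)).
  by apply: sub_finite_set (finite_II n) => _ [B [_ fB] <-].
have [s Ds] : exists s : seq (set X), D `&` [set B | (f B < n)%N] = [set` s].
  by move/finite_seqP : finD => [s ->]; exists s.
have sP B : B \in s -> D B.
  by move=> Bs; have : [set` s] B by []; rewrite -Ds => -[].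
have fU : finite_meas mu (\bigcup_(B in [set` s]) B).
  by apply: finite_meas_bigcup_seq => B /sP/Db/ball_finite.
rewrite /F Ds (meas_fine fU) lee_fin.
apply: le_trans (finite_vitali mW _) _.
  by move=> B /sP DB; split; [exact: Db|case: (DP _ DB)].
rewrite ler_wpM2l//; first by rewrite mulr_ge0.
apply: fine_measS => //; first by apply: measurableI => //; case: fU.
move=> x [Wx [B /sP DB Bx]].
by have [_] := DP _ DB; apply; split.
Qed.

(** * Points of half density *)

Definition dense_in (F : set X) B := balls B /\ m B <= 2 * m (B `&` F).

(** The points of [F] in no half filled ball form a set [N]. A ball meeting [N] has more than half
    of its measure outside [N]; so if balls approximate [N], Vitali applied to the complement of [N]
    shows that those meeting [N] have a small union, and hence [N] is null. *)
Lemma dense_ball_ae F : finite_meas mu F ->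
  mu (F `\` \bigcup_(B in dense_in F) B) = 0%E.
Proof.
move=> fF.
have mU : measurable (\bigcup_(B in dense_in F) B).
  by apply: (ball_separable bb) => B [].
set N := F `\` _.
have mN : measurable N by apply: measurableD => //; case: fF.
have fN : finite_meas mu N by apply: (finite_measS fF) => //; exact: subDsetl.
have [[x Nx]|/forallNP N0] := pselect (exists x, N x); last first.
  by rewrite (_ : N = set0) ?measure0// -subset0 => x /N0.
have [B0 [bB0 _ _]] := ball_two_points bb x x.
have K1 := hull_const_ge1 bB0.
rewrite meas_fine//; congr EFin; apply/eqP; rewrite eq_le fine_meas_ge0 andbT.
apply/ler_addgt0Pr => e e0; rewrite add0r.
(* The error allowed in (B3) is paid once for the part of [N] left uncovered and [2 * K] times
   through Vitali. *)
have C0 : 0 < 2 * K + 1 by lra.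
have [D [cD Db De]] := ball_approx bb mN (divr_gt0 e0 C0).
set e' := e / _ in De.
have e'0 : 0 < e' by rewrite divr_gt0.
pose D' := D `&` [set B | B `&` N !=set0].
have D'b : D' `<=` balls by move=> B [/Db].
have mD : measurable (\bigcup_(B in D) B) by exact: (ball_separable bb).
have mD' : measurable (\bigcup_(B in D') B) by exact: (ball_separable bb).
have mE : measurable (N `+` \bigcup_(B in D) B).
  by rewrite /setY; apply: measurableU; exact: measurableD.
have fE : finite_meas mu (N `+` \bigcup_(B in D) B).
  by split=> //; apply: lt_trans De _; rewrite ltry.
have {}De : m (N `+` \bigcup_(B in D) B) < e' by rewrite -lte_fin -meas_fine.
have DD : \bigcup_(B in D') B `<=` \bigcup_(B in D) B.
  by move=> y [B [DB _] By]; exists B.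
pose Z := (\bigcup_(B in D') B) `\` N.
have mZ : measurable Z by exact: measurableD.
have ZE : Z `<=` N `+` \bigcup_(B in D) B.
  by move=> y [/DD yD yN]; rewrite /setY; right.
have fZ : finite_meas mu Z by exact: (finite_measS fE).
have Vit : (mu (\bigcup_(B in D') B) <= (2 * K * m Z)%:E)%E.
  apply: (@countable_vitali (~` N)) => //.
  - lra.
  - exact: measurableC.
  - by apply: sub_countable cD; apply: subset_card_le => B [].
  move=> B D'B; split; last by move=> y [Ny By]; split=> //; exists B.
  have [DB [y [By Ny]]] := D'B; have bB := Db _ DB; have fB := ball_finite bB.
  have nB : ~ dense_in F B by move=> dB; case: Ny => _; apply; exists B.
  have {}nB : 2 * m (B `&` F) < m B.
    by rewrite ltNge; apply/negP => h; apply: nB.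
  have h1 := fine_measID fB mN.
  have h2 : m (B `&` N) <= m (B `&` F).
    apply: fine_measS.
    - apply: (finite_measS fB); last exact: subIsetl.
      by apply: measurableI; [case: fB|case: fF].
    - by apply: measurableI => //; case: fB.
    - by apply: setIS; exact: subDsetl.
  move: h1; rewrite setDE; lra.
have fD' : finite_meas mu (\bigcup_(B in D') B).
  by split=> //; apply: le_lt_trans Vit _; rewrite ltry.
have {}Vit : m (\bigcup_(B in D') B) <= 2 * K * m Z.
  by rewrite -lee_fin -meas_fine.
have mND : measurable (N `\` \bigcup_(B in D') B) by exact: measurableD.
have fND : finite_meas mu (N `\` \bigcup_(B in D') B).
  by apply: (finite_measS fN) => //; exact: subDsetl.
have h1 : m Z <= e'.
  by apply: le_trans (ltW De); exact: fine_measS.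
have h2 : m (N `\` \bigcup_(B in D') B) <= e'.
  apply: le_trans (ltW De); apply: fine_measS => // y [Ny yD'].
  rewrite /setY; left; split=> // -[B DB By]; apply: yD'.
  by exists B => //; split=> //; exists y.
have h3 : m N <= m (N `\` \bigcup_(B in D') B) + m (\bigcup_(B in D') B).
  apply: le_trans (fine_measU_le fND fD'); apply: fine_measS => //.
    exact: finite_measU.
  move=> y Ny; have [|] := pselect ((\bigcup_(B in D') B) y); first by right.
  by left.
have -> : e = (2 * K + 1) * e' by rewrite /e' mulrC divfK// gt_eqF.
have : 2 * K * m Z <= 2 * K * e' by rewrite ler_wpM2l//; lra.
lra.
Qed.

End Balls.

(** The history is coded as a finite list built by [rcons], with [t0] only a default for [nth]; the
    second hypothesis says that [S] looks at no value of index [n] or more. *)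
Lemma course_of_values_choice (T : Type) (t0 : T)
    (S : (nat -> T) -> nat -> T -> Prop) :
  (forall f n, exists t, S f n t) ->
  (forall f g n t, (forall k, (k < n)%N -> f k = g k) -> S f n t -> S g n t) ->
  exists f, forall n, S f n (f n).
Proof.
move=> Sex Sext.
have [g gP] := choice (fun s : seq T => Sex (nth t0 s) (size s)).
pose st := fix st n := if n is n'.+1 then rcons (st n') (g (st n')) else [::].
have st_size n : size (st n) = n by elim: n => //= n IH; rewrite size_rcons IH.
have st_nth n k : (k < n)%N -> nth t0 (st n) k = g (st k).
  elim: n => // n IH; rewrite ltnS leq_eqVlt /= nth_rcons st_size => /predU1P[->|kn].
    by rewrite ltnn eqxx.
  by rewrite kn IH.
exists (g \o st) => n; have := gP (st n); rewrite st_size /=.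
by apply: Sext => k kn; rewrite st_nth.
Qed.

(** The ball of a node is at most [M * K ^+ 2] times its core. The square of this factor arises when
    the ball of a child is compared with the core of its parent. *)
Lemma alpha_le2 (R : realFieldType) (K M alpha : R) :
  1 <= K -> K <= M -> 0 < alpha -> alpha * (10 * K ^+ 5 * M ^+ 2) <= 1 ->
  alpha * (M ^+ 2 * K ^+ 4) <= 10^-1.
Proof.
move=> K1 KM alpha0 alpha_small.
have h : M ^+ 2 * K ^+ 4 <= K ^+ 5 * M ^+ 2.
  rewrite (_ : K ^+ 5 * M ^+ 2 = (M ^+ 2 * K ^+ 4) * K); last by ring.
  rewrite ler_peMr// mulr_ge0// exprn_ge0//; lra.
apply: le_trans (ler_wpM2l (ltW alpha0) h) _.
by move: alpha_small; rewrite -!mulrA mulrCA; lra.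
Qed.

Lemma alpha_le1 (R : realFieldType) (K M alpha : R) :
  1 <= K -> K <= M -> 0 < alpha -> alpha * (10 * K ^+ 5 * M ^+ 2) <= 1 ->
  alpha * (M * K ^+ 2) <= 10^-1.
Proof.
move=> K1 KM alpha0 alpha_small; have M1 := le_trans K1 KM.
apply: le_trans (alpha_le2 K1 KM alpha0 alpha_small).
rewrite ler_wpM2l ?(ltW alpha0)//.
rewrite (_ : M ^+ 2 * K ^+ 4 = M * K ^+ 2 * (M * K ^+ 2)); last by ring.
have MK1 : 1 <= M * K ^+ 2 by rewrite mulr_ege1 ?exprn_ege1.
by rewrite ler_peMr//; lra.
Qed.

(** * Greedy selection of nodes *)

(** [mid] is a double hull of the core. It is kept apart from [ball], which has to be strictly
    larger when doubling is used to get away from a half filled [mid]. [parent] is an index into the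
    sequence of nodes. *)
Record node (X : Type) := Node
  { core : set X; terr : set X; mid : set X; ball : set X; parent : nat }.

(* Fills the sequence of nodes once no candidate is left. *)
Definition empty_node (X : Type) : node X := Node set0 set0 set0 set0 0.

Section Selection.
Context {R : realType} {d : measure_display} {X : measurableType d}.
Variables (mu : {measure set X -> \bar R}) (balls : set (set X)) (K M : R).
Variables (F : set X -> set X) (alpha : R) (P : set X -> set X -> Prop).

Local Notation m A := (fine (mu A)).

(** Two hulls cost the factor [K ^+ 2]; [M] leaves room for one enlargement by the doubling
    constant. *)
Definition good_node (u : node X) := [/\ balls (core u),
  hull_ball mu balls K (core u) (terr u), hull_ball mu balls K (terr u) (mid u),
  balls (ball u) /\ mid u `<=` ball u & m (ball u) <= M * K ^+ 2 * m (core u)].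

(** [P] stands for the conclusion of (a4), kept abstract so that one construction serves both
    general and doubling ball-bases. *)
Definition child_node (A : set X) (u : node X) :=
  [/\ good_node u, m (core u) <= 2 * m (core u `&` F A) & P A (ball u)].

Definition candidate (nd : nat -> node X) (n : nat) (u : node X) :=
  [/\ (parent u < n)%N, balls (ball (nd (parent u))),
    child_node (ball (nd (parent u))) u &
    exists x, [/\ core u x, terr (nd (parent u)) x &
      forall k, (parent u < k < n)%N -> ~ terr (nd k) x]].

Definition selected (nd : nat -> node X) (n : nat) (u : node X) :=
  (u = empty_node X /\ forall v, ~ candidate nd n v) \/
  (candidate nd n u /\
   forall v, candidate nd n v -> m (core v) <= 2 * m (core u)).

Hypothesis bb : ball_basis mu balls K.
Hypothesis F_meas : forall B, balls B ->
  finite_meas mu (F B) /\ m (F B) < alpha * m B.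

Lemma candidate_ext f g n u : (forall k, (k < n)%N -> f k = g k) ->
  candidate f n u -> candidate g n u.
Proof.
move=> fg [un]; rewrite fg// => bu cu [x [ux tx xk]]; split=> //; exists x.
by split=> // k /andP[uk kn]; rewrite -fg//; apply: xk; rewrite uk.
Qed.

Lemma core_child_le A u : balls A -> child_node A u -> m (core u) <= 2 * m (F A).
Proof.
move=> bA [[bu _ _ _ _] uF _]; apply: le_trans uF _; rewrite ler_wpM2l//.
have [fF _] := F_meas bA.
apply: fine_measS => //.
by apply: measurableI; [exact: (ball_measurable bb)|case: fF].
Qed.

Lemma selection_exists (root : node X) : exists nd : nat -> node X,
  nd 0%N = root /\ forall n, (0 < n)%N -> selected nd n (nd n).
Proof.
have [||nd ndP] := @course_of_values_choice _ root
    (fun f n u => if n is 0%N then u = root else selected f n u).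
- move=> f [|n]; first by exists root.
  have [c|nc] := pselect (exists u, candidate f n.+1 u); last first.
    by exists (empty_node X); left; split=> // v cv; apply: nc; exists v.
  (* A candidate may have any earlier node as parent; summing over all of them bounds its core
     independently of that choice. *)
  have [|u [cu umax]] := @exists_half_max R (node X) (candidate f n.+1)
      (fun u => m (core u)) (\sum_(k < n.+1) 2 * m (F (ball (f k)))) c.
    move=> u [un bu cu _]; apply/andP; split.
      by have [[bcu _ _ _ _] _ _] := cu; exact: ball_fine_gt0 bb _ bcu.
    apply: le_trans (core_child_le bu cu) _.
    rewrite (bigD1 (Ordinal un))//= lerDl; apply: sumr_ge0 => i _.
    by apply: mulr_ge0 => //; exact: fine_meas_ge0.
  by exists u; right; split.
- move=> f g [|n] u fg // [[-> nc]|[cu umax]].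
    left; split=> // v cv; apply: (nc v); apply: candidate_ext cv.
    by move=> k kn; rewrite fg.
  right; split; first exact: candidate_ext cu.
  by move=> v cv; apply: umax; apply: candidate_ext cv => k kn; rewrite fg.
exists nd; split; first exact: ndP 0%N.
by move=> [|n] // _; exact: ndP n.+1.
Qed.

End Selection.

(** * Estimates along a greedy selection *)

Section SelectedNodes.
Context {R : realType} {d : measure_display} {X : measurableType d}.
Variables (mu : {measure set X -> \bar R}) (balls : set (set X)) (K M : R).
Variables (F : set X -> set X) (alpha : R) (P : set X -> set X -> Prop).

Local Notation m A := (fine (mu A)).

Hypothesis bb : ball_basis mu balls K.
Hypothesis K1 : 1 <= K.
Hypothesis KM : K <= M.
Hypothesis alpha0 : 0 < alpha.
Hypothesis alpha_small : alpha * (10 * K ^+ 5 * M ^+ 2) <= 1.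
Hypothesis F_meas : forall B, balls B ->
  finite_meas mu (F B) /\ m (F B) < alpha * m B.
Hypothesis child_ex : forall A x, balls A -> F A x ->
  (\bigcup_(B in dense_in mu balls (F A)) B) x ->
  exists u : node X, child_node mu balls K M F P A u /\ core u x.

Variable nd : nat -> node X.
Hypothesis root_good : good_node mu balls K M (nd 0%N).
Hypothesis nd_sel : forall n, (0 < n)%N ->
  selected mu balls K M F P nd n (nd n).

Local Notation b n := (core (nd n)).
Local Notation t n := (terr (nd n)).
Local Notation c n := (mid (nd n)).
Local Notation a n := (ball (nd n)).
Local Notation p n := (parent (nd n)).
Local Notation w n := (m (b n)).

(** * Sizes and nesting of the nodes *)

Let M1 : 1 <= M. Proof. exact: le_trans KM. Qed.

Let KMs : [/\ 1 <= K ^+ 2, 1 <= K ^+ 4, 1 <= M * K ^+ 2 & K ^+ 2 <= M * K ^+ 2].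
Proof.
have K2 := exprn_ege1 2 K1; have K4 := exprn_ege1 4 K1.
by split; rewrite ?mulr_ege1 ?ler_peMl//; lra.
Qed.

Let alphaMK : alpha * (M * K ^+ 2) <= 10^-1.
Proof. exact: alpha_le1. Qed.

Let alphaMMK : alpha * (M ^+ 2 * K ^+ 4) <= 10^-1.
Proof. exact: alpha_le2. Qed.

(** The filler node has an empty core, which is not a ball, so this tells genuine nodes from
    filler. *)
Definition live n := balls (b n).

Lemma live_good n : live n -> good_node mu balls K M (nd n).
Proof.
case: n => [//|n] ln; have := @nd_sel n.+1 (ltn0Sn n).
move=> [[h _]|[[_ _ [] //]]].
by move: ln; rewrite /live h => /(ball_neq0 bb) [].
Qed.

Lemma not_live n : ~ live n -> nd n = empty_node X.
Proof.
case: n => [|n] ln; first by case: root_good.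
have := @nd_sel n.+1 (ltn0Sn n).
by move=> [[]//|[[_ _ [[]] //]]].
Qed.

Lemma core_finite n : finite_meas mu (b n).
Proof.
have [|/not_live ->] := pselect (live n); last exact: finite_meas0.
exact: (ball_finite bb).
Qed.

Lemma core_live n : b n !=set0 -> live n.
Proof. by have [//|/not_live -> []] := pselect (live n). Qed.

Lemma terr_live n : t n !=set0 -> live n.
Proof. by have [//|/not_live -> []] := pselect (live n). Qed.

Lemma live_w n : live n <-> 0 < w n.
Proof.
split; first exact: (ball_fine_gt0 bb).
by have [//|/not_live ->/=] := pselect (live n); rewrite measure0 ltxx.
Qed.

Lemma w_ge0 n : 0 <= w n. Proof. exact: fine_meas_ge0. Qed.

Lemma node_sub n : live n -> [/\ b n `<=` t n, t n `<=` c n & c n `<=` a n].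
Proof.
move=> /live_good [bb1 h1 h2 [_ h3] _]; split=> //; first exact: (hull_sub bb).
by apply: (hull_sub bb) => //; case: h1.
Qed.

Lemma node_balls n : live n -> [/\ balls (t n), balls (c n) & balls (a n)].
Proof. by move=> /live_good [_ [? _ _] [? _ _] [? _] _]. Qed.

Lemma ball_le n : live n -> m (a n) <= M * K ^+ 2 * w n.
Proof. by move=> /live_good []. Qed.

Lemma terr_le n : live n -> m (t n) <= K * w n.
Proof. by move=> /live_good [? ? _ _ _]; exact: (hull_fine_le bb). Qed.

Lemma mid_le n : live n -> m (c n) <= K ^+ 2 * w n.
Proof.
move=> ln; have [bn h1 h2 _ _] := live_good ln; have := terr_le ln.
move=> h; apply: le_trans (hull_fine_le bb (hull_ball_ball h1) h2) _.
by rewrite expr2 -mulrA ler_wpM2l// (le_trans _ K1).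
Qed.

Lemma live_spec n : (0 < n)%N -> live n ->
  [/\ (p n < n)%N, live (p n), child_node mu balls K M F P (a (p n)) (nd n) &
    exists x, [/\ b n x, t (p n) x &
      forall k, (p n < k < n)%N -> ~ t k x]].
Proof.
move=> n0 ln; have [[h _]|[[pn bp ch [x [bx tx kx]]] _]] := nd_sel n0.
  by move: ln; rewrite /live h => /(ball_neq0 bb) [].
split=> //; last by exists x.
by apply: terr_live; exists x.
Qed.

Lemma core_child n : (0 < n)%N -> live n -> w n <= 2 * alpha * m (a (p n)).
Proof.
move=> n0 ln; have [_ lp ch _] := live_spec n0 ln.
have [_ _ ba] := node_balls lp.
have := core_child_le bb F_meas ba ch.
have [_] := F_meas ba; lra.
Qed.

Lemma core_child_w n : (0 < n)%N -> live n -> w n <= 5^-1 * w (p n).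
Proof.
move=> n0 ln; have h := core_child n0 ln; have [_ lp _ _] := live_spec n0 ln.
have h1 : alpha * m (a (p n)) <= alpha * (M * K ^+ 2 * w (p n)).
  by rewrite ler_wpM2l ?(ltW alpha0)//; exact: ball_le.
have := ler_wpM2r (w_ge0 (p n)) alphaMK; rewrite -!mulrA in h h1 *; lra.
Qed.

(** If the parent of [l] is [k] or younger, the core shrinks from parent to child and the bound
    passes through the parent by induction. Otherwise node [l] was already a candidate at stage [k],
    with the same witness point, and node [k] was chosen nearly largest. *)
Lemma w_decr k l : (k <= l)%N -> w l <= 2 * w k.
Proof.
elim/ltn_ind: l => l IH; rewrite leq_eqVlt => /predU1P[->|kl].
  by have := w_ge0 l; lra.
have [ll|/not_live ->/=] := pselect (live l); last first.
  by rewrite measure0/=; have := w_ge0 k; lra.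
have l0 : (0 < l)%N by exact: leq_ltn_trans kl.
have [pl lp ch [x [bx tx nx]]] := live_spec l0 ll.
have [kp|pk] := leqP k (p l).
  by have := IH _ pl kp; have := core_child_w l0 ll; have := w_ge0 (p l); have := w_ge0 k; lra.
have k0 : (0 < k)%N by exact: leq_ltn_trans pk.
have ck : candidate mu balls K M F P nd k (nd l).
  split=> //; first by case: (node_balls lp).
  by exists x; split=> // j /andP[pj jk]; apply: nx; rewrite pj (ltn_trans jk).
have [[_ nc]|[_]] := nd_sel k0; first by case: (nc (nd l)).
exact.
Qed.

Lemma live_down k l : (k <= l)%N -> live l -> live k.
Proof. by move=> kl /live_w; have := w_decr kl; rewrite live_w; lra. Qed.

Lemma meet_parent k l : (k < l)%N -> b k `&` b l !=set0 -> (k <= p l)%N.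
Proof.
move=> kl [y [bk bl]]; have ll : live l by apply: core_live; exists y.
have l0 : (0 < l)%N by exact: leq_ltn_trans kl.
have [pl lp ch [x [bx tx nx]]] := live_spec l0 ll.
(* [b l] lies in the hull [t k], so the point that singled out [p l] would also lie in the younger
   territory [t k]. *)
rewrite leqNgt; apply/negP => pk; apply: (nx k); first by rewrite pk.
have lk : live k := live_down (ltnW kl) ll.
have [bk' hk _ _ _] := live_good lk.
apply: (hull_star bb bk' hk ll (w_decr (ltnW kl)) _) bx.
by exists y.
Qed.

(** Two levels of smallness make [a l] smaller than the core of the parent, while [a l] meets
    [t (p l)]; so the hull of that territory contains it. This gives (a1) and, more precisely,
    confines children to [mid]. *)
Lemma ball_sub_mid l : (0 < l)%N -> live l -> a l `<=` c (p l).
Proof.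
move=> l0 ll; have [pl lp ch [x [bx tx _]]] := live_spec l0 ll.
have [bp hp hp2 _ _] := live_good lp.
have [_ _ bal] := node_balls ll.
apply: (hull_star bb (hull_ball_ball hp) hp2 bal); last first.
  exists x; split=> //; have [h1 h2 h3] := node_sub ll.
  exact/h3/h2/h1.
have := ball_le ll; have := core_child l0 ll; have := ball_le lp.
have : w (p l) <= m (t (p l)).
  by apply: (fine_meas_ball bb (core_finite _)); [case: hp|case: (node_sub lp)].
have [K2 K4 MK1 MK2] := KMs.
move=> h1 h2 h3 h4; apply: le_trans h4 _.
have h5 : M * K ^+ 2 * w l <= M * K ^+ 2 * (2 * alpha * (M * K ^+ 2 * w (p l))).
  rewrite ler_wpM2l//; first lra.
  apply: le_trans h3 _; rewrite ler_wpM2l//.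
  by rewrite mulr_ge0// ltW.
apply: le_trans h5 _.
rewrite (_ : _ * _ = 2 * (alpha * (M ^+ 2 * K ^+ 4)) * w (p l)); last by ring.
have : 2 * (alpha * (M ^+ 2 * K ^+ 4)) * w (p l) <= 1 * w (p l).
  by rewrite ler_wpM2r ?w_ge0//; move: alphaMMK; lra.
move: h1 (w_ge0 (p l)); lra.
Qed.

Lemma ball_child_lt l : (0 < l)%N -> live l -> m (a l) < m (a (p l)).
Proof.
move=> l0 ll; have [pl lp _ _] := live_spec l0 ll.
have := ball_le ll; have := core_child l0 ll.
have [_ _ /(ball_fine_gt0 bb)] := node_balls lp.
have [K2 K4 MK1 MK2] := KMs => h1 h2 h3.
have h4 : M * K ^+ 2 * w l <= M * K ^+ 2 * (2 * alpha * m (a (p l))).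
  by rewrite ler_wpM2l//; lra.
have : M * K ^+ 2 * (2 * alpha * m (a (p l))) <= 5^-1 * m (a (p l)).
  rewrite (_ : _ * _ = 2 * (alpha * (M * K ^+ 2)) * m (a (p l))); last by ring.
  by rewrite ler_wpM2r; move: alphaMK; lra.
lra.
Qed.

(** * Packing estimates for the cores *)

(** If the cores met, the parent of [l] would be [k] or younger, so its core would be at most
    [2 * w k], a small fraction of the ball shared by both parents; but that ball is at most
    [M * K ^+ 2] times the core of [p l]. Parents are compared by their balls because different
    nodes may carry the same ball. *)
Lemma siblings_disjoint k l : (0 < k)%N -> (k < l)%N -> a (p k) = a (p l) ->
  b k `&` b l = set0.
Proof.
move=> k0 kl apkl; apply/eqP/negPn/negP => /set0P kl0.
have lk : live k by apply: core_live; case: kl0 => x []; exists x.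
have ll : live l by apply: core_live; case: kl0 => x []; exists x.
have l0 := ltn_trans k0 kl.
have [pl lp _ _] := live_spec l0 ll.
have kpl := meet_parent kl kl0.
have := w_decr kpl; have := core_child k0 lk; have := ball_le lp; rewrite apkl.
have [_ _ /(ball_fine_gt0 bb)] := node_balls lp.
have [K2 K4 MK1 MK2] := KMs => h1 h2 h3 h4.
have h5 : M * K ^+ 2 * w (p l) <= M * K ^+ 2 * (2 * (2 * alpha * m (a (p l)))).
  by rewrite ler_wpM2l//; lra.
have : M * K ^+ 2 * (2 * (2 * alpha * m (a (p l)))) <= (2 / 5) * m (a (p l)).
  rewrite (_ : _ * _ = 4 * (alpha * (M * K ^+ 2)) * m (a (p l))); last by ring.
  by rewrite ler_wpM2r; move: alphaMK; lra.
lra.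
Qed.

(** At least half of each core lies in [F A], and these portions are disjoint. *)
Lemma children_sum A n (Q : pred nat) : balls A ->
  (forall k, Q k -> live k -> (0 < k)%N /\ a (p k) = A) ->
  \sum_(k < n | Q k) w k <= 2 * m (F A).
Proof.
move=> bA QA; have [fF _] := F_meas bA.
have mFA : measurable (F A) by case: fF.
have disj i k : Q i -> Q k -> (i < k)%N ->
    (b i `&` F A) `&` (b k `&` F A) = set0.
  move=> Qi Qk ik; have [li|/not_live ->] := pselect (live i); last by rewrite /= !set0I.
  have [lk|/not_live ->] := pselect (live k); last by rewrite /= !set0I setI0.
  have [i0 ai] := QA _ Qi li; have [_ ak] := QA _ Qk lk.
  rewrite setIACA (siblings_disjoint i0 ik) ?set0I//.
  by rewrite ai ak.
have h := @sum_fine_meas_le _ _ _ mu n Q (fun k => b k `&` F A) (F A) fF.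
apply: (@le_trans _ _ (2 * \sum_(k < n | Q k) m (b k `&` F A))).
  rewrite mulr_sumr; apply: ler_sum => k Qk.
  have [lk|/not_live ->/=] := pselect (live k); last first.
    by rewrite set0I measure0 mulr0.
  have [k0 ak] := QA _ Qk lk.
  by have [_ _ [_ + _] _] := live_spec k0 lk; rewrite ak.
rewrite ler_wpM2l//; apply: h => //.
by move=> i; apply: measurableI => //; case: (core_finite i).
Qed.

(** The nodes are grouped by parent and [children_sum] is applied in each group: the children of [i]
    weigh at most [2 * m (F (a i))], and [F (a i)] is small compared with [b i]. *)
Lemma sum_by_parent (Q I : pred nat) n :
  (forall k, Q k -> live k -> (0 < k)%N /\ I (p k)) ->
  \sum_(k < n | Q k) w k <= 2 * alpha * (M * K ^+ 2) * \sum_(i < n | I i) w i.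
Proof.
move=> QI.
pose Q' k := Q k && `[< live k >].
have -> : \sum_(k < n | Q k) w k = \sum_(k < n | Q' k) w k.
  rewrite big_mkcond [RHS]big_mkcond; apply: eq_bigr => k _; rewrite /Q'.
  case: (Q k) => //=; case: asboolP => // /not_live ->/=.
  by rewrite measure0.
(* The parent index as an element of ['I_n]; the default [k] is never taken for live nodes of [Q],
   since there [p k < k]. *)
pose p' (k : 'I_n) : 'I_n := insubd k (p k).
have p'E (k : 'I_n) : Q' k -> val (p' k) = p k.
  move=> /andP[Qk /asboolP lk]; have [k0 _] := QI _ Qk lk.
  have [pk _ _ _] := live_spec k0 lk.
  by rewrite val_insubd (ltn_trans pk).
rewrite (partition_big p' (fun i : 'I_n => I i)); last first.
  move=> k Qk; rewrite (p'E _ Qk); case/andP: Qk => Qk /asboolP lk.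
  by case: (QI _ Qk lk).
rewrite mulr_sumr; apply: ler_sum => i Ii.
have [li|nli] := pselect (live i); last first.
  rewrite big1; last first.
    move=> k /andP[Qk /eqP pk]; case: nli; rewrite -pk (p'E _ Qk).
    case/andP: Qk => Qk /asboolP lk; have [k0 _] := QI _ Qk lk.
    by case: (live_spec k0 lk).
  have [K2 K4 MK1 MK2] := KMs.
  by rewrite !mulr_ge0 ?w_ge0 ?(ltW alpha0)// ?(le_trans ler01).
have [_ _ bai] := node_balls li.
have -> : \sum_(k < n | Q' k && (p' k == i)) w k = \sum_(k < n | Q' k && (p k == i)) w k.
  apply: eq_bigl => k; case Qk: (Q' k) => //=.
  by rewrite -(p'E _ Qk).
apply: le_trans (@children_sum (a i) n (fun k => Q' k && (p k == i)) bai _) _.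
  move=> k /andP[/andP[Qk _] /eqP pk] lk; rewrite pk; split=> //.
  by case: (QI _ Qk lk).
apply: le_trans (_ : 2 * (alpha * m (a i)) <= _).
  by rewrite ler_wpM2l// ltW//; case: (F_meas bai).
rewrite (_ : 2 * alpha * _ * _ = 2 * (alpha * (M * K ^+ 2 * w i))); last by ring.
by rewrite ler_wpM2l// ler_wpM2l ?(ltW alpha0)//; exact: ball_le.
Qed.

(** By [sum_by_parent] the nodes other than the root weigh at most a fifth of the total. *)
Lemma sum_w n : \sum_(k < n) w k <= 5 / 4 * w 0%N.
Proof.
have h : \sum_(k < n) w k <= w 0%N + \sum_(k < n | (0 < k)%N) w k.
  case: n => [|n]; first by rewrite !big_ord0 addr0 w_ge0.
  rewrite big_ord_recl/= lerD2l [leRHS]big_mkcond big_ord_recl/= add0r.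
  by apply: ler_sum => i _.
have := @sum_by_parent (fun k => 0 < k)%N predT n (fun k k0 _ => conj k0 isT).
have S0 : 0 <= \sum_(k < n) w k by apply: sumr_ge0 => i _; exact: w_ge0.
move: h S0; set S := \sum_(k < n) w k; set T := \sum_(k < n | _) _.
move=> h S0; have := ler_wpM2r S0 alphaMK; rewrite -!mulrA; lra.
Qed.

(** Otherwise the total would diverge; by [w_decr] a single weight below [e / 2] forces all later
    ones below [e]. *)
Lemma w_small (e : R) : 0 < e -> exists n, forall k, (n <= k)%N -> w k < e.
Proof.
move=> e0; suff [n wn] : exists n, w n < e / 2.
  by exists n => k /w_decr; lra.
apply: contrapT => /forallNP h.
have {}h n : e / 2 <= w n by rewrite leNgt; apply/negP.
have e20 : 0 < e / 2 by lra.
have [n hn] : exists n, 5 / 4 * w 0%N < (e / 2) * n%:R.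
  exists (Num.bound (5 / 4 * w 0%N / (e / 2))).
  rewrite [ltRHS]mulrC -ltr_pdivrMr//; apply: archi_boundP.
  by rewrite divr_ge0 ?mulr_ge0 ?w_ge0// ltW.
have := sum_w n; apply/negP; rewrite -ltNge; apply: lt_le_trans hn _.
rewrite (_ : e / 2 * n%:R = \sum_(k < n) e / 2).
  by apply: ler_sum => k _.
by rewrite sumr_const card_ord mulr_natr.
Qed.

(** With [S] the sum: node [j] contributes [w j], the nodes of [I1] at most [2 * K ^+ 4 * w j], and
    those of [I2], whose parents are again counted in [S], at most [S / 5]. Hence [S] is at most 5/4
    of [3 * K ^+ 4 * w j]. *)
Lemma neighbours_sum (j n : nat) : live j ->
  \sum_(i < n | (j <= i)%N && `[< c i `&` b j !=set0 >]) w i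
    <= 15 / 4 * K ^+ 4 * w j.
Proof.
move=> lj; pose I i := (j <= i)%N && `[< c i `&` b j !=set0 >].
rewrite -[leLHS]/(\sum_(i < n | I i) w i).
have Ilive i : I i -> live i.
  move=> /andP[_ /asboolP[x [ci _]]].
  by have [//|/not_live h] := pselect (live i); move: ci; rewrite h.
(* I1: the nodes near b j whose parent is older than j; their cores are disjoint. *)
pose I1 i := [&& I i, (j < i)%N & (p i < j)%N].
pose I2 i := [&& I i, (j < i)%N & (j <= p i)%N].
have wj := w_ge0 j.
have I2le : \sum_(i < n | I2 i) w i
    <= 2 * alpha * (M * K ^+ 2) * \sum_(i < n | I i) w i.
  apply: sum_by_parent => i /and3P[Ii ji jp] li.
  have i0 : (0 < i)%N by exact: leq_ltn_trans ji.
  split=> //; rewrite /I jp /=; apply/asboolP.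
  case/andP: Ii => _ /asboolP[x [ci bj]]; exists x; split=> //.
  apply: (ball_sub_mid i0 li).
  by case: (node_sub li) => _ _; apply.
have [K2 K4 MK1 MK2] := KMs.
have cI1 i : I1 i -> m (c i) <= 2 * K ^+ 2 * w j.
  move=> /and3P[Ii ji _]; apply: le_trans (mid_le (Ilive _ Ii)) _.
  rewrite (_ : 2 * _ * _ = K ^+ 2 * (2 * w j)); last by ring.
  by rewrite ler_wpM2l// ?w_decr// ?(ltnW ji)//; lra.
(* If every such [c i] has measure at most [2 * w j], the hull [t j] of [b j] contains them all.
   Otherwise a nearly largest [c i] is larger than [b j], so its hull [H] contains [b j], and a hull
   of [H] contains every [c k], as each meets [b j]. *)
have [Z [fZ mZ cZ]] : exists Z, [/\ finite_meas mu Z, m Z <= 2 * K ^+ 4 * w j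
    & forall i, (i < n)%N -> I1 i -> c i `<=` Z].
  have [[i0 [i0n Ii0 ci0]]|nbig] :=
      pselect (exists i, [/\ (i < n)%N, I1 i & 2 * w j < m (c i)]).
    have [|i [i1n Ii1]|i [[iin Ii] imax]] := @exists_half_max R nat
        (fun i => (i < n)%N /\ I1 i) (fun i => m (c i)) (2 * K ^+ 2 * w j).
    - by exists i0.
    - rewrite cI1// andbT; case/andP: Ii1 => /Ilive li _.
      by have [_ bc _] := node_balls li; exact: ball_fine_gt0 bb _ bc.
    have li : live i by case/andP: Ii => /Ilive.
    have [_ bci _] := node_balls li.
    have [H hH] := ball_hull bb bci; have bH := hull_ball_ball hH.
    have [Z hZ] := ball_hull bb bH; have bZ := hull_ball_ball hZ.
    exists Z; split; first exact: (ball_finite bb).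
      have h1 := hull_fine_le bb bci hH; have h2 := hull_fine_le bb bH hZ.
      have h3 : K * m H <= K * (K * m (c i)) by rewrite ler_wpM2l// (le_trans ler01).
      have h4 : K ^+ 2 * m (c i) <= K ^+ 2 * (2 * K ^+ 2 * w j).
        by rewrite ler_wpM2l ?cI1//; lra.
      apply: le_trans h2 _; apply: le_trans h3 _.
      rewrite mulrA -expr2; apply: le_trans h4 _.
      by rewrite le_eqVlt; apply/orP; left; apply/eqP; ring.
    have cij (k : nat) : I1 k -> c k `&` b j !=set0.
      by move=> /andP[/andP[_ /asboolP]].
    have bjH : b j `<=` H.
      apply: (hull_star bb bci hH lj); last by rewrite setIC; exact: cij.
      have := imax i0 (conj i0n Ii0); move: ci0; lra.
    move=> k kn Ik; have lk : live k by case/andP: Ik => /Ilive.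
    have [_ bck _] := node_balls lk.
    apply: (hull_star bb bH hZ bck).
      have := imax k (conj kn Ik).
      have := fine_meas_ball bb (ball_finite bb bci) bH (hull_sub bb bci hH); lra.
    by have [x [ck bj]] := cij _ Ik; exists x; split=> //; exact: bjH.
  have [bj' hj _ _ _] := live_good lj; have btj := hull_ball_ball hj.
  exists (t j); split; first exact: (ball_finite bb).
    apply: le_trans (terr_le lj) _; rewrite ler_wpM2r//.
    have K3 := exprn_ege1 3 K1.
    have : K * 1 <= K * K ^+ 3 by rewrite ler_wpM2l// (le_trans ler01).
    by rewrite mulr1 -exprS; move: K4; lra.
  move=> i i_n Ii; have li : live i by case/andP: Ii => /Ilive.
  have [_ bci _] := node_balls li.
  apply: (hull_star bb bj' hj bci).
    by rewrite leNgt; apply/negP => h; apply: nbig; exists i.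
  by case/andP: Ii => /andP[_ /asboolP].
have I1le : \sum_(i < n | I1 i) w i <= 2 * K ^+ 4 * w j.
  apply: le_trans mZ.
  have h := @sum_fine_meas_le _ _ _ mu n I1 (fun k => b k) Z fZ.
  apply: h.
  - by move=> i; case: (core_finite i).
  - move=> i i_n Ii; have li : live i by case/andP: Ii => /Ilive.
    have [s1 s2 _] := node_sub li.
    by move=> x /s1/s2; exact: cZ.
  (* If these cores met, the parent of [k] would have index at least [i], hence above [j], whereas
     it is below [j]. *)
  - move=> i k /and3P[Ii ji pij] /and3P[Ik jk pkj] ik.
    apply/eqP/negPn/negP => /set0P/(meet_parent ik) ipk.
    by have := leq_trans ipk (ltnW pkj); rewrite leqNgt ji.
have split3 : \sum_(i < n | I i) w i <=
    \sum_(i < n | i == j :> nat) w i + \sum_(i < n | I1 i) w i + \sum_(i < n | I2 i) w i.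
  rewrite big_mkcond [X in _ <= X + _ + _]big_mkcond [X in _ <= _ + X + _]big_mkcond.
  rewrite [X in _ <= _ + X]big_mkcond -!big_split/=.
  apply: ler_sum => i _; rewrite /I1 /I2; have wi := w_ge0 i.
  case Ii: (I i) => /=; last by rewrite !addr0; case: ifP.
  have [ij|ij] := eqVneq (nat_of_ord i) j; first by rewrite ij ltnn /= !addr0.
  have -> : (j < i)%N by rewrite ltn_neqAle eq_sym ij; case/andP: Ii.
  by rewrite /=; case: ltnP; rewrite ?add0r ?addr0.
have jle : \sum_(i < n | i == j :> nat) w i <= w j.
  have [jn|nj] := ltnP j n; first by rewrite (big_pred1 (Ordinal jn)).
  rewrite big_pred0// => i; apply/eqP => ij.
  by have := ltn_ord i; rewrite ij ltnNge nj.
have S0 : 0 <= \sum_(i < n | I i) w i by apply: sumr_ge0 => i _; exact: w_ge0.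
have := ler_wpM2r S0 alphaMK; move: I2le split3; rewrite -!mulrA.
have : 1 * w j <= K ^+ 4 * w j by rewrite ler_wpM2r.
move: I1le; rewrite -!mulrA mul1r.
move: jle; lra.
Qed.

(** A later core meeting [b j] has its parent among the nodes of [neighbours_sum]. The constant is
    [2 * alpha * (M * K ^+ 2)] times [15 / 4 * K ^+ 4], at most 3/4 because [K <= M]. For [M = K]
    the seventh power of [K] in the bound on [alpha] is exactly spent here. *)
Lemma later_cores_sum (j n : nat) : live j ->
  \sum_(k < n | (j < k)%N && `[< b j `&` b k !=set0 >]) w k <= 3 / 4 * w j.
Proof.
move=> lj; have wj := w_ge0 j; have K4 := exprn_ege1 4 K1.
apply: le_trans (@sum_by_parent
  (fun k => (j < k)%N && `[< b j `&` b k !=set0 >])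
  (fun i => (j <= i)%N && `[< c i `&` b j !=set0 >]) n _) _.
  move=> k /andP[jk /asboolP bjk] lk.
  have k0 : (0 < k)%N by exact: leq_ltn_trans jk.
  split=> //; apply/andP; split; first exact: meet_parent.
  have [x [bj bk]] := bjk; apply/asboolP; exists x; split=> //.
  apply: (ball_sub_mid k0 lk); have [s1 s2 s3] := node_sub lk.
  exact/s3/s2/s1.
have aMK0 : 0 <= 2 * alpha * (M * K ^+ 2).
  by rewrite !mulr_ge0 ?(ltW alpha0)// (le_trans ler01).
apply: le_trans (ler_wpM2l aMK0 (neighbours_sum n lj)) _.
have h : M * K ^+ 6 <= K ^+ 5 * M ^+ 2.
  rewrite (_ : M * K ^+ 6 = (K ^+ 5 * M) * K); last by ring.
  rewrite (_ : K ^+ 5 * M ^+ 2 = (K ^+ 5 * M) * M); last by ring.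
  by rewrite ler_wpM2l// mulr_ge0 ?exprn_ge0// (le_trans ler01).
have {}h := ler_wpM2l (ltW alpha0) h.
have h10 : 10 * (alpha * (K ^+ 5 * M ^+ 2)) <= 1.
  by move: alpha_small; rewrite -!mulrA mulrCA.
rewrite [leLHS](_ : _ = 15 / 2 * (alpha * (M * K ^+ 6)) * w j); last by field.
rewrite ler_wpM2r//; move: h h10; lra.
Qed.

(** * Parts of cores left by later cores *)

Definition own_part n := b n `\` \bigcup_(k in [set k | (n < k)%N]) b k.

Lemma own_part_measurable n : measurable (own_part n).
Proof.
apply: measurableD; first by case: (core_finite n).
by apply: bigcup_measurable => k _; case: (core_finite k).
Qed.

(** Later cores that miss [b n] remove nothing; those that meet it cover at most 3/4 of it by
    countable subadditivity. *)
Lemma own_part_ge n : live n -> 4^-1 * w n <= m (own_part n).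
Proof.
move=> ln; pose Q k := (n < k)%N && `[< b n `&` b k !=set0 >].
pose U := \bigcup_(k in [set k | (n < k)%N]) b k.
have mU : measurable U by apply: bigcup_measurable => k _; case: (core_finite k).
have fn := core_finite n.
have fI : finite_meas mu (b n `&` U).
  apply: (finite_measS fn); last exact: subIsetl.
  by apply: measurableI => //; case: fn.
have h : m (b n `&` U) <= 3 / 4 * w n.
  rewrite -lee_fin -meas_fine//.
  apply: le_trans (_ : (\sum_(k <oo | Q k) mu (b k) <= _)%E); last first.
    apply: nneseries_fine_meas_le; first exact: core_finite.
    by move=> N; exact: later_cores_sum.
  rewrite eseries_mkcond.
  rewrite (eq_eseriesr (g := fun k => mu (if Q k then b k else set0))); last first.
    by move=> k _; case: (Q k); rewrite ?measure0.
  apply: measure_sigma_subadditive.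
  - by move=> k; case: (Q k) => //; case: (core_finite k).
  - by case: fI.
  move=> x [bn [k nk bk]]; exists k => //.
  by rewrite /Q (_ : (n < k)%N)//= ifT//; apply/asboolP; exists x.
have := fine_measID fn mU; rewrite -/(own_part n).
move: h; lra.
Qed.

Lemma own_part_disjoint k l : (k < l)%N -> own_part k `&` own_part l = set0.
Proof.
by move=> kl; rewrite -subset0 => x [[_ nx] [bl _]]; apply: nx; exists l.
Qed.

(** * Covering almost every point *)

(** At a filler node [F] is evaluated at the empty set, where it is uncontrolled; hence the
    alternative. *)
Lemma node_finite n :
  [/\ finite_meas mu (t n), finite_meas mu (a n) & finite_meas mu (F (a n)) \/ ~ live n].
Proof.
have [ln|nl] := pselect (live n).
  have [bt bc ba] := node_balls ln; have [fF _] := F_meas ba.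
  by split; [exact: (ball_finite bb)|exact: (ball_finite bb)|left].
by split; [..|by right]; rewrite (not_live nl); exact: finite_meas0.
Qed.

Lemma nodes_cover :
  mu.-negligible (t 0%N `\` \bigcup_(n in live) (a n `\` F (a n))).
Proof.
pose N n := if `[< live n >] then
  F (a n) `\` \bigcup_(B in dense_in mu balls (F (a n))) B else set0.
(* The exceptional set: points in infinitely many territories, null by Borel-Cantelli since the
   territories have finite total measure, and points of some [F (a n)] in no ball half filled by
   it. *)
apply: (@negligibleS _ _ _ _ (lim_sup_set (fun n => t n) `|` \bigcup_n N n)); last first.
  apply: negligibleU.
    apply/negligibleP.
      apply: bigcap_measurable => // k _.
      by apply: bigcup_measurable => i _; case: (node_finite i) => -[].
    apply: lim_sup_set_cvg0; first by move=> k; case: (node_finite k) => -[].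
    apply: le_lt_trans (ltry (K * (5 / 4 * w 0%N))).
    apply: (@nneseries_fine_meas_le _ _ _ mu xpredT); first by move=> k; case: (node_finite k).
    move=> n; apply: le_trans (ler_wpM2l _ (sum_w n)); last exact: le_trans K1.
    rewrite mulr_sumr; apply: ler_sum => k _.
    have [lk|nl] := pselect (live k); first exact: terr_le.
    by rewrite (not_live nl)/= measure0/= mulr0.
  apply: negligible_bigcup => n; rewrite /N.
  case: asboolP => ln; last exact: negligible_set0.
  have [_ _ [fF|//]] := node_finite n.
  apply/negligibleP; last exact: (dense_ball_ae bb).
  apply: measurableD; first by case: fF.
  by apply: (ball_separable bb) => B [].
move=> x [t0x nx]; have [|nlim] := pselect (lim_sup_set (fun n => t n) x); first by left.
have [n0 hn0] : exists n0, forall n, (n0 <= n)%N -> ~ t n x.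
  apply: contrapT => /forallNP h; apply: nlim => n _.
  apply: contrapT => hn; apply: (h n) => k nk tk; apply: hn.
  by exists k.
(* The last territory containing [x]; one exists as [x] is in that of the root. *)
have [i ti imax] : exists2 i, t i x & forall k, (i < k)%N -> ~ t k x.
  have exi : exists i, `[< t i x >] by exists 0%N; apply/asboolP.
  have bnd i : `[< t i x >] -> (i <= n0)%N.
    by move=> /asboolP ti; rewrite leqNgt; apply/negP => /ltnW/hn0.
  have [i /asboolP ti imax] := ex_maxnP exi bnd.
  exists i => // k ik tk; have : (k <= i)%N by apply: imax; apply/asboolP.
  by rewrite leqNgt ik.
have li : live i by apply: terr_live; exists x.
have [_ s2 s3] := node_sub li; have [_ _ bai] := node_balls li.
have aix : a i x by exact/s3/s2.
have Fx : F (a i) x by apply: contrapT => nF; apply: nx; exists i.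
right; exists i => //; rewrite /N; case: asboolP => // _; split=> // dx.
have [u [cu ux]] := child_ex bai Fx dx.
have u0 : 0 < m (core u) by case: cu => -[bu _ _ _ _] _ _; exact: (ball_fine_gt0 bb).
(* From stage [l] on cores weigh less than half of [core u], yet [u] with parent [i] is a candidate
   there: this contradicts the choice of node [l]. *)
have [k hk] := @w_small (m (core u) / 2) ltac:(by rewrite divr_gt0).
pose l := maxn k i.+1.
(* The parent index recorded in [u] is arbitrary. *)
pose u' := Node (core u) (terr u) (mid u) (ball u) i.
have l0 : (0 < l)%N by rewrite /l leq_max orbT.
have cl : candidate mu balls K M F P nd l u'.
  split=> //=; first by rewrite /l leq_max leqnn orbT.
  exists x; split=> // q /andP[iq _]; exact: imax.
have [[_ /(_ u')]//|[_ /(_ _ cl)/=]] := nd_sel l0.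
have : w l < m (core u) / 2 by apply: hk; exact: leq_maxl.
lra.
Qed.

(** * From nodes to a tree of balls *)

Definition first_index n := live n /\ forall k, (k < n)%N -> a k <> a n.

Lemma first_index_ex n : live n ->
  exists k, [/\ (k <= n)%N, first_index k & a k = a n].
Proof.
elim/ltn_ind: n => n IH ln.
have [[k [kn akn]]|nk] := pselect (exists k, (k < n)%N /\ a k = a n).
  have [q [qk fq aq]] := IH _ kn (live_down (ltnW kn) ln).
  by exists q; split=> //; [exact: leq_trans (ltnW kn)|rewrite aq].
exists n; split=> //; split=> // k kn akn; apply: nk; by exists k.
Qed.

Lemma first_index_inj k l : first_index k -> first_index l -> a k = a l -> k = l.
Proof.
move=> [_ fk] [_ fl] akl; have [h|h|//] := ltngtP k l; first by case: (fl _ h).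
by case: (fk _ h).
Qed.

(* Distinct nodes may carry the same ball, so a ball of the tree is represented
   by the first node carrying it, and inherits the parent of that node. *)
Definition node_balls_set : set (set X) := [set a n | n in live].

Definition node_children (A : set X) : set (set X) :=
  [set a n | n in [set n | [/\ (0 < n)%N, first_index n & a (p n) = A]]].

Lemma nodes_tree : tree_collection balls node_balls_set node_children (a 0%N).
Proof.
split.
- by move=> _ [n ln <-]; case: (node_balls ln).
- by exists 0%N => //; case: root_good.
- by move=> A _ _ [n [_ [ln _] _] <-]; exists n.
- move=> A _ [n [n0 [ln _] apn] anA].
  by have := ball_child_lt n0 ln; rewrite apn anA ltxx.
- suff H n : live n -> exists (q : nat) (e : nat -> set X),
      [/\ e 0%N = a 0%N, e q = a n, forall j, (j <= q)%N -> node_balls_set (e j)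
        & forall j, (j < q)%N -> node_children (e j) (e j.+1)].
    by move=> _ [n ln <-]; exact: H.
  (* Strong induction on the index: the parent of the first node [k] carrying [a n] has a smaller
     index, and its chain is prolonged by [a k]. That parent need not itself be a first node. *)
  elim/ltn_ind: n => n IH ln.
  have [k [kn fk akn]] := first_index_ex ln.
  have lk : live k by case: fk.
  rewrite -akn; have [k0|k0] := posnP k.
    exists 0%N, (fun=> a 0%N); rewrite k0; split=> // j _.
    by exists 0%N => //; rewrite -k0.
  have [pk lpk _ _] := live_spec k0 lk.
  have [q [e [e0 eq eS eC]]] := IH _ (leq_trans pk kn) lpk.
  exists q.+1, (fun j => if (j <= q)%N then e j else a k); split=> //.
  + by rewrite ltnn.
  + by move=> j _; case: ifP => jq; [exact: eS|exists k].
  + move=> j; rewrite ltnS => jq; rewrite jq; case: ifP => jq'; first exact: eC.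
    have -> : j = q by apply/eqP; rewrite eqn_leq jq/= leqNgt jq'.
    by rewrite eq; exists k.
- move=> A A' _ _ _ [n [_ fn <-] <-] [k [_ fk <-] akn].
  by rewrite (first_index_inj fk fn akn).
Qed.

(** The set attached to a ball is the own part of the first node carrying it: at least a quarter of
    a core, which in turn is at least [(M * K ^+ 2)^-1] times the ball. *)
Lemma nodes_sparse : sparse mu (4 * (M * K ^+ 2))^-1 node_balls_set.
Proof.
have rex G : exists n, node_balls_set G -> first_index n /\ a n = G.
  have [[n ln anG]|nG] := pselect (node_balls_set G); last by exists 0%N.
  have [k [_ fk akn]] := first_index_ex ln.
  by exists k => _; split=> //; rewrite akn.
have [r rP] := choice rex.
exists (own_part \o r); split.
  move=> G G' SG SG' /= GG'; have [_ <-] := rP _ SG; have [_ <-] := rP _ SG'.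
  have [h|h|->//] := ltngtP (r G) (r G').
    by case: GG' => x; rewrite own_part_disjoint.
  by case: GG' => x; rewrite setIC own_part_disjoint.
move=> G SG; have [[lr _] rG] := rP _ SG; split => /=.
- exact: own_part_measurable.
- move=> x [bx _]; have [s1 s2 s3] := node_sub lr; rewrite -rG.
  exact/s3/s2/s1.
have [bt bc ba] := node_balls lr.
have fE : finite_meas mu (own_part (r G)).
  by apply: (finite_measS (core_finite (r G))); [exact: own_part_measurable|exact: subDsetl].
rewrite (meas_fine fE) -{1}rG (meas_fine (ball_finite bb ba)) -EFinM lee_fin.
apply: le_trans (own_part_ge lr); have [_ _ MK1 _] := KMs.
have MK0 : 0 < M * K ^+ 2 by lra.
rewrite invfM -mulrA ler_wpM2l// mulrC ler_pdivrMr// mulrC.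
exact: ball_le.
Qed.

Lemma children_esum A : node_balls_set A ->
  (\esum_(G in node_children A) mu G <= (2 * (M * K ^+ 2) * alpha)%:E * mu A)%E.
Proof.
move=> [i li aiA]; have [_ _ bA] := node_balls li; rewrite aiA in bA.
pose Q : pred nat := fun n => `[< [/\ (0 < n)%N, first_index n & a (p n) = A] >].
have -> : node_children A = [set a n | n in Q].
  by apply/seteqP; split=> _ [n Qn <-]; exists n => //; apply/asboolP.
rewrite esum_pred_image//; last first.
  move=> k l /set_mem/asboolP[_ fk _] /set_mem/asboolP[_ fl _].
  exact: (first_index_inj fk fl).
rewrite (meas_fine (ball_finite bb bA)) -EFinM.
apply: nneseries_fine_meas_le => [k|n]; first by case: (node_finite k).
have [K2 K4 MK1 MK2] := KMs.
apply: (@le_trans _ _ (M * K ^+ 2 * \sum_(k < n | Q k) w k)).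
  rewrite mulr_sumr; apply: ler_sum => k /asboolP[_ [lk _] _].
  exact: ball_le.
rewrite (_ : 2 * _ * _ * _ = M * K ^+ 2 * (2 * (alpha * m A))); last by ring.
rewrite ler_wpM2l//; first lra.
apply: le_trans (@children_sum A n Q bA _) _.
  by move=> k /asboolP[k0 _ apk].
by rewrite ler_wpM2l// ltW//; case: (F_meas bA).
Qed.

End SelectedNodes.

(** * The sparse tree *)

Section SparseTree.
Context {R : realType} {d : measure_display} {X : measurableType d}.
Variables (mu : {measure set X -> \bar R}) (balls : set (set X)) (K M : R).
Variables (F : set X -> set X) (alpha : R) (P : set X -> set X -> Prop).

Local Notation m A := (fine (mu A)).

Hypothesis bb : ball_basis mu balls K.
Hypothesis KM : K <= M.
Hypothesis alpha0 : 0 < alpha.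
Hypothesis alpha_small : alpha * (10 * K ^+ 5 * M ^+ 2) <= 1.
Hypothesis F_meas : forall B, balls B ->
  finite_meas mu (F B) /\ m (F B) < alpha * m B.

Lemma sparse_tree :
  (forall A x, balls A -> F A x ->
    (\bigcup_(B in dense_in mu balls (F A)) B) x ->
    exists u : node X, child_node mu balls K M F P A u /\ core u x) ->
  forall A0 H0 HH0 : set X, balls A0 ->
  hull_ball mu balls K A0 H0 -> hull_ball mu balls K H0 HH0 ->
  exists (S : set (set X)) (Ch : set X -> set (set X)),
    countable S /\ tree_collection balls S Ch HH0 /\
    sparse mu (4 * (M * K ^+ 2))^-1 S /\
    (forall A G, S A -> Ch A G -> G `<=` A) /\
    mu (A0 `\` \bigcup_(A in S) (A `\` F A)) = 0%E /\
    (forall A, S A ->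
      (\esum_(G in Ch A) mu G <= (2 * (M * K ^+ 2) * alpha)%:E * mu A)%E) /\
    (forall A G, S A -> Ch A G -> P A G).
Proof.
move=> child_ex A0 H0 HH0 bA0 hH0 hHH0.
have K1 := hull_const_ge1 bb bA0.
have bH0 := hull_ball_ball hH0; have bHH0 := hull_ball_ball hHH0.
(* The core [A0] makes [HH0] the ball and puts [A0] inside the territory of the root; the parent
   index 0 is a placeholder. *)
pose root := Node A0 H0 HH0 HH0 0%N.
have root_good : good_node mu balls K M root.
  split=> //=; first by split.
  apply: le_trans (hull_fine_le bb bH0 hHH0) _.
  have h : K * m H0 <= K * (K * m A0).
    rewrite ler_wpM2l//; first exact: le_trans K1.
    exact: (hull_fine_le bb).
  apply: le_trans h _; rewrite mulrA -expr2 ler_wpM2r ?fine_meas_ge0//.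
  rewrite ler_peMl//; last exact: le_trans KM.
  by rewrite exprn_ge0// (le_trans _ K1).
have [nd [nd0 nd_sel]] := selection_exists M P bb F_meas root.
rewrite -nd0 in root_good.
exists (node_balls_set balls nd), (node_children balls nd).
have mS (A : set X) : node_balls_set balls nd A -> measurable (A `\` F A).
  move=> [n ln <-]; have [_ _ ba] := node_balls bb root_good nd_sel ln.
  have [[mF _] _] := F_meas ba.
  by apply: measurableD => //; exact: (ball_measurable bb).
have cS : countable (node_balls_set balls nd).
  by apply: sub_countable (card_image_le _ _) _; exact: countableP.
split=> //; split.
  have := nodes_tree bb K1 KM alpha0 alpha_small F_meas root_good nd_sel.
  by rewrite nd0.
split; first exact: (nodes_sparse bb K1 KM alpha0 alpha_small F_meas root_good nd_sel).
split.
  move=> A _ SA [n [n0 [ln _] <-] <-].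
  have [_ lp _ _] := live_spec bb root_good nd_sel n0 ln.
  have [_ _ s3] := node_sub bb root_good nd_sel lp.
  by move=> x /(ball_sub_mid bb K1 KM alpha0 alpha_small F_meas root_good nd_sel n0 ln)/s3.
split.
  apply/negligibleP.
    apply: measurableD; first exact: (ball_measurable bb).
    rewrite bigcup_image; apply: bigcup_measurable => n ln.
    by apply: mS; exists n.
  apply: negligibleS (nodes_cover bb K1 KM alpha0 alpha_small F_meas child_ex root_good nd_sel).
  rewrite nd0 /= => x [A0x nx]; split; first exact: (hull_sub bb bA0 hH0).
  move=> [n ln fx]; apply: nx; exists (ball (nd n)) => //.
  by exists n.
split.
  move=> A SA; exact: (children_esum bb K1 KM alpha0 alpha_small F_meas root_good nd_sel SA).
move=> A _ _ [n [n0 [ln _] <-] <-].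
by have [_ _ [_ _ ?] _] := live_spec bb root_good nd_sel n0 ln.
Qed.

(** * Choice of the core of a child *)

Lemma half_measure_dense A G : balls A -> balls G -> ~ dense_in mu balls (F A) G ->
  (mu (G `&` F A) < (2^-1)%:E * mu G)%E.
Proof.
move=> bA bG nG; have [fF _] := F_meas bA; have fG := ball_finite bb bG.
have fI : finite_meas mu (G `&` F A).
  by apply: (finite_measS fG) => //; apply: measurableI; [case: fG|case: fF].
rewrite (meas_fine fI) (meas_fine fG) -EFinM lte_fin.
have : ~ m G <= 2 * m (G `&` F A) by move=> h; apply: nG.
move=> /negP; rewrite -ltNge; lra.
Qed.

Lemma near_max_dense_ball A x : balls A ->
  (\bigcup_(B in dense_in mu balls (F A)) B) x ->
  exists B, [/\ dense_in mu balls (F A) B, B x & forall B',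
    dense_in mu balls (F A) B' -> B' x -> m B' <= 2 * m B].
Proof.
move=> bA [B0 dB0 B0x]; have [fF _] := F_meas bA.
have [||B [[dB Bx] Bmax]] := @exists_half_max R (set X)
    (fun B => dense_in mu balls (F A) B /\ B x) (fun B => m B) (2 * m (F A)).
- by exists B0.
- move=> B [[bB hB] _]; rewrite (ball_fine_gt0 bb bB)/=.
  apply: le_trans hB _; rewrite ler_wpM2l//; apply: fine_measS => //.
  by apply: measurableI; [exact: (ball_measurable bb)|case: fF].
by exists B; split=> // B' dB' B'x; exact: Bmax.
Qed.

(** A half filled ball [G] strictly containing [C] would contain [x], so by near maximality it would
    be at most twice [B] and lie in the hull [T] of [B], hence in [C]. *)
Lemma maximal_dense_ball A x : balls A ->
  (\bigcup_(B in dense_in mu balls (F A)) B) x ->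
  exists B T C, [/\ dense_in mu balls (F A) B, B x, hull_ball mu balls K B T,
    hull_ball mu balls K T C &
    [/\ balls C, m C <= K ^+ 2 * m B & forall G, balls G -> C `<` G ->
     ~ dense_in mu balls (F A) G]].
Proof.
move=> bA /(near_max_dense_ball bA)[B [dB Bx Bmax]]; have [bB hB] := dB.
have [T hT] := ball_hull bb bB; have bT := hull_ball_ball hT.
have [C hC] := ball_hull bb bT; have bC := hull_ball_ball hC.
exists B, T, C; split=> //; split=> //.
  apply: le_trans (hull_fine_le bb bT hC) _.
  rewrite expr2 -mulrA ler_wpM2l//; last exact: (hull_fine_le bb bB).
  exact: le_trans (hull_const_ge1 bb bB).
move=> G bG [CG nGC] dG; apply: nGC.
have BC : B `<=` C by move=> y /(hull_sub bb bB hT)/(hull_sub bb bT hC).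
have Gx : G x by exact/CG/BC.
have GT : G `<=` T by apply: (hull_star bb bB hT bG (Bmax _ dG Gx)); exists x.
by move=> y /GT/(hull_sub bb bT hC).
Qed.

End SparseTree.

(** * General and doubling ball-bases *)

Local Open Scope ereal_scope.

(* In the doubling part the bound on alpha is 1 / (10 K^5 max(K, eta)^2), which
   is 1 / (10 K^7) as soon as eta <= K.  With 1 / (10 K^7) and no relation between
   K and eta that part is false: take 100-adic intervals (K = 1, eta = 100),
   A0 = [0,1[, F A0 = [0,1/100[, alpha = 1/20. *)
Theorem proposition3p1 (R : realType) :
  (forall K : R, exists gamma c : R, [/\ (0 < gamma)%R, (gamma < 1)%R, (0 < c)%R &
    forall (d : measure_display) (X : measurableType d)
      (mu : {measure set X -> \bar R}) (balls : set (set X))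
      (F : set X -> set X) (alpha : R),
    ball_basis mu balls K ->
    (0 < alpha)%R -> (alpha < (10 * K ^+ 7)^-1)%R ->
    (forall B, balls B -> measurable (F B) /\ mu (F B) < alpha%:E * mu B) ->
    forall A0 H0 HH0 : set X, balls A0 ->
    hull_ball mu balls K A0 H0 -> hull_ball mu balls K H0 HH0 ->
    exists (S : set (set X)) (Ch : set X -> set (set X)),
      countable S /\ tree_collection balls S Ch HH0 /\ sparse mu gamma S /\
      (forall A G, S A -> Ch A G -> G `<=` A) /\
      mu (A0 `\` \bigcup_(A in S) (A `\` F A)) = 0 /\
      (forall A, S A -> \esum_(G in Ch A) mu G <= (c * alpha)%:E * mu A) /\
      (forall A G, S A -> Ch A G -> forall G', balls G' -> G `<` G' ->
        mu (G' `&` F A) < (2^-1)%:E * mu G')])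
  /\
  (forall K eta : R, exists gamma c : R, [/\ (0 < gamma)%R, (gamma < 1)%R, (0 < c)%R &
    forall (d : measure_display) (X : measurableType d)
      (mu : {measure set X -> \bar R}) (balls : set (set X))
      (F : set X -> set X) (alpha : R),
    ball_basis mu balls K -> doubling mu balls eta ->
    (0 < alpha)%R -> (alpha < (10 * K ^+ 5 * Num.max K eta ^+ 2)^-1)%R ->
    (forall B, balls B -> measurable (F B) /\ mu (F B) < alpha%:E * mu B) ->
    forall A0 H0 HH0 : set X, balls A0 ->
    hull_ball mu balls K A0 H0 -> hull_ball mu balls K H0 HH0 ->
    exists (S : set (set X)) (Ch : set X -> set (set X)),
      countable S /\ tree_collection balls S Ch HH0 /\ sparse mu gamma S /\
      (forall A G, S A -> Ch A G -> G `<=` A) /\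
      mu (A0 `\` \bigcup_(A in S) (A `\` F A)) = 0 /\
      (forall A, S A -> \esum_(G in Ch A) mu G <= (c * alpha)%:E * mu A) /\
      (forall A G, S A -> Ch A G -> forall G', balls G' -> G `<=` G' ->
        mu (G' `&` F A) < (2^-1)%:E * mu G')]).
Proof.
(* The constants are fixed before any ball-basis, when [1 <= K] is not yet known; hence the maximum
   with 1, which disappears once a ball is at hand. *)
have gamma_c (N : R) : [/\ (0 < (4 * Num.max 1 N)^-1)%R,
    ((4 * Num.max 1 N)^-1 < 1)%R & (0 < 2 * Num.max 1 N)%R].
  have N1 : (1 <= Num.max 1 N)%R by rewrite le_max lexx.
  have N4 : (1 < 4 * Num.max 1 N)%R by lra.
  split; [|by rewrite invf_lt1//; lra|lra].
  by rewrite invr_gt0; lra.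
have F_meas (d : measure_display) (X : measurableType d)
    (mu : {measure set X -> \bar R}) (balls : set (set X)) (K : R)
    (F : set X -> set X) (alpha : R) : ball_basis mu balls K ->
    (forall B, balls B -> measurable (F B) /\ mu (F B) < alpha%:E * mu B) ->
    forall B, balls B ->
      finite_meas mu (F B) /\ (fine (mu (F B)) < alpha * fine (mu B))%R.
  move=> bb hF B bB; have [mF] := hF B bB.
  rewrite (meas_fine (ball_finite bb bB)) -EFinM => FB.
  have fF : finite_meas mu (F B) by split=> //; apply: lt_trans FB _; rewrite ltry.
  by split=> //; rewrite -lte_fin -(meas_fine fF).
split=> [K|K eta].
- have [g0 g1 c0] := gamma_c (K * K ^+ 2)%R.
  exists (4 * Num.max 1 (K * K ^+ 2))^-1%R, (2 * Num.max 1 (K * K ^+ 2))%R.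
  split=> // d X mu balls F alpha bb alpha0 alphaK hF A0 H0 HH0 bA0 hH0 hHH0.
  have K1 := hull_const_ge1 bb bA0.
  have {}hF := F_meas _ _ _ _ _ _ _ bb hF.
  have alpha_small : (alpha * (10 * K ^+ 5 * K ^+ 2) <= 1)%R.
    rewrite -mulrA -exprD -ler_pdivlMr ?div1r ?ltW//.
    by rewrite mulr_gt0// exprn_gt0// (lt_le_trans ltr01).
  rewrite (max_idPr _); last by rewrite mulr_ege1// exprn_ege1.
  apply: (sparse_tree (P := fun A G => forall G', balls G' -> G `<` G' ->
    mu (G' `&` F A) < (2^-1)%:E * mu G') bb (lexx K) alpha0 alpha_small hF _ bA0 hH0 hHH0).
  move=> A x bA FAx /(maximal_dense_ball bb hF bA).
  move=> [B [T [C [[bB hB] Bx hT hC [bC mC Cmax]]]]].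
  (* Here [M = K], and the double hull [C] itself is the ball of the child. *)
  exists (Node B T C C 0); split=> //; split=> //=; last first.
    by move=> G bG CG; apply: (half_measure_dense bb hF bA bG); exact: Cmax.
  split=> //=; first by split.
  apply: le_trans mC _; rewrite ler_wpM2r ?fine_meas_ge0// ler_peMl//.
  by rewrite exprn_ge0// (le_trans _ K1).
- pose M := Num.max K eta.
  have [g0 g1 c0] := gamma_c (M * K ^+ 2)%R.
  exists (4 * Num.max 1 (M * K ^+ 2))^-1%R, (2 * Num.max 1 (M * K ^+ 2))%R.
  split=> // d X mu balls F alpha bb [eta1 db] alpha0 alphaK hF A0 H0 HH0 bA0 hH0 hHH0.
  have K1 := hull_const_ge1 bb bA0.
  have {}hF := F_meas _ _ _ _ _ _ _ bb hF.
  have KM : (K <= M)%R by rewrite le_max lexx.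
  have eM : (eta <= M)%R by rewrite le_max lexx orbT.
  have M1 := le_trans K1 KM.
  have K20 : (0 <= K ^+ 2)%R by rewrite exprn_ge0// (le_trans _ K1).
  have alpha_small : (alpha * (10 * K ^+ 5 * M ^+ 2) <= 1)%R.
    rewrite -ler_pdivlMr ?div1r ?ltW//.
    by rewrite !mulr_gt0 ?exprn_gt0//; exact: lt_le_trans ltr01 _.
  rewrite (max_idPr _); last by rewrite mulr_ege1// exprn_ege1.
  apply: (sparse_tree (P := fun A G => forall G', balls G' -> G `<=` G' ->
    mu (G' `&` F A) < (2^-1)%:E * mu G') bb KM alpha0 alpha_small hF _ bA0 hH0 hHH0).
  move=> A x bA FAx /(maximal_dense_ball bb hF bA).
  move=> [B [T [C [[bB hB] Bx hT hC [bC mC Cmax]]]]].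
  have mC' : (fine (mu C) <= M * K ^+ 2 * fine (mu B))%R.
    apply: le_trans mC _; rewrite ler_wpM2r ?fine_meas_ge0//.
    by rewrite ler_peMl.
  have [dC|nC] := pselect (dense_in mu balls (F A) C); last first.
    exists (Node B T C C 0); split=> //; split=> //=.
      by split=> //=; split.
    move=> G bG CG.
    apply: (half_measure_dense bb hF bA bG).
    have [GC|nGC] := pselect (G `<=` C); last by apply: Cmax.
    by rewrite (_ : G = C)//; apply/seteqP.
  (* Otherwise a hull of [C] would contain [A], whose measure is too large. *)
  have starC : star mu balls C <> setT.
    move=> sC; have [H hH] := ball_hull bb bC.
    have AH : A `<=` H by move=> y _; case: hH => _ sH _; apply: sH; rewrite sC.
    have h1 := fine_meas_ball bb (ball_finite bb bA) (hull_ball_ball hH) AH.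
    have h2 := hull_fine_le bb bC hH.
    have h3 : (K * fine (mu C) <= K * (K ^+ 2 * fine (mu B)))%R.
      by rewrite ler_wpM2l// (le_trans _ K1).
    have [fF FA] := hF _ bA.
    have h4 : (fine (mu (B `&` F A)) <= fine (mu (F A)))%R.
      by apply: fine_measS => //; apply: measurableI; [exact: (ball_measurable bb)|case: fF].
    have h5 : (K ^+ 2 * fine (mu B) <= K ^+ 2 * (2 * (alpha * fine (mu A))))%R.
      by rewrite ler_wpM2l//; lra.
    have h6 : (K * (K ^+ 2 * fine (mu B)) <= M * (K ^+ 2 * (2 * (alpha * fine (mu A)))))%R.
      apply: ler_pM => //; first exact: le_trans K1.
      by rewrite mulr_ge0// fine_meas_ge0.
    have h7 : (M * (K ^+ 2 * (2 * (alpha * fine (mu A)))) <= 5^-1 * fine (mu A))%R.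
      rewrite [leLHS](_ : _ = 2 * (alpha * (M * K ^+ 2)) * fine (mu A))%R; last by ring.
      rewrite ler_wpM2r ?fine_meas_ge0//.
      by have := alpha_le1 K1 KM alpha0 alpha_small; lra.
    by have := ball_fine_gt0 bb bA; lra.
  have [G [bG CG mG]] := db C bC starC.
  have {}mG : (fine (mu G) <= eta * fine (mu C))%R.
    move: mG; rewrite (meas_fine (ball_finite bb bG)) (meas_fine (ball_finite bb bC)).
    by rewrite -EFinM lee_fin.
  (* A ball containing [G] strictly contains [C], so it is not half filled; the doubling constant is
     absorbed by [M]. *)
  exists (Node B T C G 0); split=> //; split=> //=; last first.
    move=> G' bG' GG'; apply: (half_measure_dense bb hF bA bG'); apply: Cmax => //.
    by case: CG => CG nGC; split; [exact: subset_trans GG'|move/(subset_trans GG')].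
  split=> //=; first by split=> //; case: CG.
  apply: le_trans mG _; rewrite -mulrA; apply: ler_pM => //.
    by apply: le_trans (ltW eta1).
Qed.
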